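(* (Dimension-independence of the harmonic null space.) In any dimension, the harmonic (topological) sector of the Berry curvature of a Bloch band is a constant form and therefore contributes exactly zero to the field-driven current-noise covariance described in the context, for every chemical potential, every temperature, and every band structure. The anomalous-Hall vector is a noiseless quantum number in three dimensions as in two.
   Context: Setting: the Brillouin zone is the flat torus $\mathbb{T}^d$, and $\Omega$ is the Berry curvature 2-form of an isolated band or group of bands, with Hodge decomposition $\Omega=\gamma+d\mathcal{A}+\delta\mathcal{B}$ into harmonic ($\Delta\gamma=0$), exact and co-exact parts. For $d=3$ the 2-form is identified with the pseudovector $\Omega_a=\frac12\epsilon_{abc}\Omega_{bc}$, and the decomposition is the Helmholtz decomposition $\boldsymbol{\Omega}=\langle\boldsymbol{\Omega}\rangle+\boldsymbol{\Omega}_\perp+\boldsymbol{\Omega}_\parallel$ into a constant field (harmonic, encoding the anomalous-Hall vector), a divergence-free field (exact) and a curl-free field (co-exact). The curvature of a gapless band may be singular at Weyl nodes ($|\boldsymbol{\Omega}|\sim1/r^2$, not square-integrable). In that case the decomposition is understood in the distributional sense, and statements are read mode by mode (spectrally) or at finite lattice resolution. Thermal measure: with equilibrium Fermi occupation $f_0$ for band energy $\varepsilon$, chemical potential $\mu$ and inverse temperature $\beta$, set $D=f_0(1-f_0)=\frac14\operatorname{sech}^2[\beta(\varepsilon-\mu)/2]$, $\mathcal{Z}=\int_{\mathbb{T}^d}D\,d^dk$, $p=D/\mathcal{Z}$, $\langle g\rangle_p=\int g\,p\,d^dk$. Noise covariance: the occupation fluctuates under particle-conserving Langevin–Boltzmann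 dynamics whose noise correlator is fixed by the fluctuation-dissipation theorem, namely $\langle\xi(\mathbf{k},t)\xi(\mathbf{k}',t')\rangle=\frac{2}{\tau}\frac{(2\pi)^d}{V_{\mathrm{sys}}}\big[D(\mathbf{k})\delta(\mathbf{k}-\mathbf{k}')-D(\mathbf{k})D(\mathbf{k}')/\mathcal{Z}\big]\delta(t-t')$, with $\tau$ the relaxation time and $V_{\mathrm{sys}}$ the system volume. In three dimensions the anomalous Hall current is $\bar J^i=-e^2\epsilon^{ijk}E_j(2\pi)^{-3}\int_{\mathbb{T}^3}\Omega_kf\,d^3k$ in an electric field $E$, and the low-frequency current-noise tensor is $$S^{ij}(0)\propto\epsilon^{iab}\epsilon^{jcd}E_aE_c\,\mathcal{Z}\,\mathrm{Cov}_p(\Omega_b,\Omega_d),\qquad\mathrm{Cov}_p(\Omega_b,\Omega_d)=\langle\Omega_b\Omega_d\rangle_p-\langle\Omega_b\rangle_p\langle\Omega_d\rangle_p$$ (repeated indices summed). In two dimensions the corresponding quantity is $\mathcal{Z}\,\mathrm{Var}_p(\Omega_z)$, where $\Omega=\Omega_z\,dk_x\wedge dk_y$. ''Contributes exactly zero'' means that the terms of the covariance involving the harmonic part drop out, because $\mathrm{Cov}_p(\mathrm{const},\cdot)=0$. ''Noiseless'' means that the anomalous-Hall vector gives no contribution to this noise. *)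

(* Defs.v *)
From HB Require Import structures.
From mathcomp Require Import all_boot all_order all_algebra.
From mathcomp Require Import all_classical all_reals all_analysis.

Set Implicit Arguments.
Unset Strict Implicit.
Unset Printing Implicit Defensive.

Import Order.TTheory GRing.Theory Num.Theory.
Import numFieldNormedType.Exports.

Local Open Scope classical_set_scope.
Local Open Scope ring_scope.

Section Cube.
Variable R : realType.

Notation line := (measurableTypeR R).

Definition tuple_cons n (x : line * n.-tuple line) : n.+1.-tuple line :=
  [the n.+1.-tuple line of x.1 :: x.2].

Lemma measurable_tuple_cons n :
  measurable_fun [set: line * n.-tuple line] (@tuple_cons n).
Proof. by apply: measurable_cons; [exact: measurable_fst|exact: measurable_snd]. Qed.

HB.instance Definition _ n :=
  isMeasurableFun.Build _ _ _ _ (@tuple_cons n) (@measurable_tuple_cons n).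

(* Lebesgue measure on the unit cube [0,1]^d, as the d-fold product of the
   uniform probability on [0,1]. *)
Fixpoint cube_measure (d : nat) : probability (d.-tuple line) R :=
  match d with
  | 0 => @dirac _ (0.-tuple line) [tuple] R
  | n.+1 => distribution (uniform_prob (@ltr01 R) \x cube_measure n)%E
                         (@tuple_cons n)
  end.

End Cube.

(* The flat torus is 'rV[R]_d modulo the lattice spanned by the rows of
   L : 'M[R]_d (L \in unitmx); the standard torus is L = (2 * pi)%:M.  Fields
   on the torus are L-periodic functions on 'rV[R]_d, and differential forms
   are given by their Cartesian components. *)
Section Torus.
Variables (R : realType) (d : nat) (L : 'M[R]_d).

Notation point := 'rV[R]_d.

Definition periodic (f : point -> R) : Prop :=
  forall (k : point) (i : 'I_d), f (k + row i L) = f k.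

(* [0,1]^d is mapped onto the unit cell spanned by the rows of L. *)
Definition cell_point (t : d.-tuple (measurableTypeR R)) : point := (\row_i tnth t i) *m L.

Definition bz_measurable (f : point -> R) : Prop :=
  measurable_fun [set: d.-tuple (measurableTypeR R)] (f \o cell_point).

Definition bz_integrable (f : point -> R) : Prop :=
  (cube_measure R d).-integrable [set: d.-tuple (measurableTypeR R)] (EFin \o (f \o cell_point)).

(* \int_(T^d) f d^dk; the factor is the Jacobian of cell_point. *)
Definition bz_int (f : point -> R) : R :=
  `|\det L| * Rintegral (cube_measure R d) [set: d.-tuple (measurableTypeR R)] (f \o cell_point).

Definition bz_mean (f : point -> R) : R := bz_int f / bz_int (fun=> 1).

Definition partial (i : 'I_d) (f : point -> R) : point -> R :=
  fun k => derive f k (delta_mx 0 i).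

Definition iter_partial (s : seq 'I_d) (f : point -> R) : point -> R :=
  foldr partial f s.

Definition smooth (f : point -> R) : Prop :=
  forall s : seq 'I_d, continuous (iter_partial s f) /\
    forall (i : 'I_d) (k : point), derivable (iter_partial s f) k (delta_mx 0 i).

Definition test_function (phi : point -> R) : Prop := smooth phi /\ periodic phi.

(* Only the values of T at test functions are relevant. *)
Definition distribution_on_torus (T : (point -> R) -> R) : Prop :=
  (forall (a : R) (phi psi : point -> R), test_function phi -> test_function psi ->
     T (fun k => a * phi k + psi k) = a * T phi + T psi) /\
  (exists (m : nat) (C : R), forall (phi : point -> R) (M : R), test_function phi ->
     (forall s : seq 'I_d, (size s <= m)%N ->
        forall k : point, `|iter_partial s phi k| <= M) ->
     `|T phi| <= C * M).

Definition dist_partial (i : 'I_d) (T : (point -> R) -> R) : (point -> R) -> R :=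
  fun phi => - T (partial i phi).

End Torus.

(* Exterior derivative and codifferential of the flat metric in components,
   for coefficients in V with partial derivatives D: V is either the type of
   functions (D = partial) or that of distributions (D = dist_partial). *)
Section Forms.
Variables (d : nat) (V : zmodType) (D : 'I_d -> V -> V).

Definition alternating2 (w : 'I_d -> 'I_d -> V) : Prop :=
  forall i j, w j i = - w i j.

Definition alternating3 (t : 'I_d -> 'I_d -> 'I_d -> V) : Prop :=
  forall i j k, t j i k = - t i j k /\ t i k j = - t i j k.

Definition ext_deriv1 (a : 'I_d -> V) : 'I_d -> 'I_d -> V :=
  fun i j => D i (a j) - D j (a i).

Definition ext_deriv2 (w : 'I_d -> 'I_d -> V) : 'I_d -> 'I_d -> 'I_d -> V :=
  fun i j k => D i (w j k) + D j (w k i) + D k (w i j).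

Definition codiff2 (w : 'I_d -> 'I_d -> V) : 'I_d -> V :=
  fun j => - \sum_i D i (w i j).

Definition codiff3 (t : 'I_d -> 'I_d -> 'I_d -> V) : 'I_d -> 'I_d -> V :=
  fun j k => - \sum_i D i (t i j k).

Definition hodge_laplacian2 (w : 'I_d -> 'I_d -> V) : 'I_d -> 'I_d -> V :=
  fun i j => ext_deriv1 (codiff2 w) i j + codiff3 (ext_deriv2 w) i j.

End Forms.

Section Hodge.
Variables (R : realType) (d : nat) (L : 'M[R]_d).

Notation field := ('rV[R]_d -> R).
Notation dist := (field -> R).

(* The Berry curvature of a band enters only as an integrable 2-form on the
   torus.  Closedness is not required: it fails at Weyl nodes, which are sources
   of the co-exact part.  Integrability, rather than
   square-integrability, admits their singularities |Omega| ~ 1 / r^2. *)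
Definition curvature_form (Omega : 'I_d -> 'I_d -> field) : Prop :=
  alternating2 Omega /\
  forall i j, periodic L (Omega i j) /\ bz_integrable L (Omega i j).

Definition harmonic_form (g : 'I_d -> 'I_d -> field) : Prop :=
  [/\ alternating2 g,
      forall i j, smooth (g i j) /\ periodic L (g i j) &
      forall i j, hodge_laplacian2 (@partial R d) g i j = 0].

(* Omega = g + dA + delta B in the sense of distributions, with g harmonic, A a
   distributional 1-form and B a distributional 3-form. *)
Definition hodge_decomposition (Omega g : 'I_d -> 'I_d -> field)
    (A : 'I_d -> dist) (B : 'I_d -> 'I_d -> 'I_d -> dist) : Prop :=
  [/\ harmonic_form g,
      forall i, distribution_on_torus L (A i),
      alternating3 B /\ (forall i j k, distribution_on_torus L (B i j k)) &
      forall (i j : 'I_d) (phi : field), test_function L phi ->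
        bz_int L (fun k => Omega i j k * phi k) =
        bz_int L (fun k => g i j k * phi k)
        + ext_deriv1 (@dist_partial R d) A i j phi
        + codiff3 (@dist_partial R d) B i j phi].

End Hodge.

Section Thermal.
Variables (R : realType) (d : nat) (L : 'M[R]_d).
Variables (beta mu : R) (eps : 'rV[R]_d -> R).

Notation field := ('rV[R]_d -> R).

Definition band_energy : Prop := periodic L eps /\ bz_measurable L eps.

Definition fermi (k : 'rV[R]_d) : R := (expR (beta * (eps k - mu)) + 1)^-1.

Definition thermal_weight (k : 'rV[R]_d) : R := fermi k * (1 - fermi k).

Definition partition_Z : R := bz_int L thermal_weight.

Definition thermal_density (k : 'rV[R]_d) : R := thermal_weight k / partition_Z.

Definition thermal_mean (f : field) : R :=
  bz_int L (fun k => f k * thermal_density k).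

Definition thermal_integrable (f : field) : Prop :=
  bz_integrable L (fun k => f k * thermal_density k).

Definition thermal_cov (f g : field) : R :=
  thermal_mean (fun k => f k * g k) - thermal_mean f * thermal_mean g.

(* The noise is quadratic in the curvature; current_noise is its polarization,
   the noise tensor of Omega being current_noise kappa E Omega Omega.  The
   current along i is proportional to \sum_a Omega_ia E_a, and kappa collects
   the prefactors (charge, relaxation time, volume, powers of 2 pi). *)
Definition current_noise (kappa : R) (E : 'I_d -> R)
    (F G : 'I_d -> 'I_d -> field) (i j : 'I_d) : R :=
  kappa * \sum_a \sum_b
    E a * E b * (partition_Z * thermal_cov (F i a) (G j b)).

End Thermal.

Section ThreeDimensions.
Variable R : realType.

Notation field := ('rV[R]_3 -> R).

(* For indices in {0,1,2}: the Vandermonde product takes the values 0, 2, -2. *)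
Definition levi_civita (a b c : 'I_3) : R :=
  (b%:R - a%:R) * (c%:R - a%:R) * (c%:R - b%:R) / 2.

Definition pseudovector (F : 'I_3 -> 'I_3 -> field) : 'I_3 -> field :=
  fun a k => 2^-1 * \sum_b \sum_c levi_civita a b c * F b c k.

(* S^ij = kappa eps^iab eps^jce E_a E_c Z Cov_p(F_b, G_e), polarized as
   current_noise; with F_ia = eps_iab F_b it agrees with current_noise. *)
Definition current_noise3 (L : 'M[R]_3) (beta mu : R) (eps : field)
    (kappa : R) (E : 'I_3 -> R) (F G : 'I_3 -> field) (i j : 'I_3) : R :=
  kappa * \sum_a \sum_b \sum_c \sum_e
    levi_civita i a b * levi_civita j c e * E a * E c *
    (partition_Z L beta mu eps * thermal_cov L beta mu eps (F b) (G e)).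

End ThreeDimensions.

Section TwoDimensions.
Variable R : realType.

Notation field := ('rV[R]_2 -> R).

Definition z_component (F : 'I_2 -> 'I_2 -> field) : field := F ord0 ord_max.

Definition current_noise2 (L : 'M[R]_2) (beta mu : R) (eps : field)
    (f g : field) : R :=
  partition_Z L beta mu eps * thermal_cov L beta mu eps f g.

End TwoDimensions.

(* Main.v *)
(* Smooth mixed partial derivatives commute, so the Hodge Laplacian of a 2-form
   on the flat torus acts componentwise as minus the scalar Laplacian, and every
   component f of a harmonic form is a harmonic periodic function.  It is
   constant by a maximum principle (Bernstein): for a derivative u of f and
   c > 0, the function u^2 + c f^2 has Laplacian
   2 |grad u|^2 + 2 c |grad f|^2 >= 0, which must vanish at a maximum point;
   there u = 0, hence u^2 <= c max f^2 everywhere, and c tends to 0.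
   Testing the distributional decomposition against 1 kills the exact and
   co-exact parts and identifies the constant with the mean of the curvature.
   Since the thermal weight is positive, p is a probability density, for which
   covariances with constants vanish. *)
Require Import Defs.
From mathcomp Require Import all_boot all_order all_algebra.
From mathcomp Require Import all_classical all_reals all_analysis.
From mathcomp Require Import measurable_realfun ring lra.

Set Implicit Arguments.
Unset Strict Implicit.
Unset Printing Implicit Defensive.

Import Order.TTheory GRing.Theory Num.Theory.
Import numFieldNormedType.Exports.

Local Open Scope classical_set_scope.
Local Open Scope ring_scope.

(** * Directional derivatives *)

Section DirectionalDerivatives.
Variables (R : realType) (V : normedModType R).
Implicit Types (f : V -> R) (u v w k : V) (s t : R).

(** Difference quotients of the restriction to the line coincide with those of [f], which opens
    directional derivatives to one-variable theorems (mean value, extremum). *)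
Lemma is_derive_line f k v t : derivable f (k + t *: v) v ->
  is_derive t 1 (fun s => f (k + s *: v)) ('D_v f (k + t *: v)).
Proof.
move=> df.
have E : (fun h : R => h^-1 *: (((fun s => f (k + s *: v)) \o shift t) (h *: 1)
                               - f (k + t *: v)))
       = (fun h => h^-1 *: ((f \o shift (k + t *: v)) (h *: v) - f (k + t *: v))).
  apply/funext => h /=; congr (_ *: (f _ - _)).
  by rewrite [h *: 1]mulr1 scalerDl addrCA.
by split; rewrite /derivable /derive ?E.
Qed.

Lemma growth_rate_translate f w x v :
  (fun h : R => h^-1 *: (((fun y => f (y + w)) \o shift x) (h *: v) - f (x + w)))
  = (fun h => h^-1 *: ((f \o shift (x + w)) (h *: v) - f (x + w))).
Proof. by apply/funext => h /=; rewrite addrA. Qed.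

Lemma derive_translate f w x v :
  'D_v (fun y => f (y + w)) x = 'D_v f (x + w).
Proof. by rewrite /derive growth_rate_translate. Qed.

Lemma derivable_translate f w x v :
  derivable f (x + w) v -> derivable (fun y => f (y + w)) x v.
Proof. by rewrite /derivable growth_rate_translate. Qed.

Lemma derive_MVT f k v t : 0 < t -> (forall x, derivable f x v) ->
  exists2 c, 0 < c < t & f (k + t *: v) - f k = t * 'D_v f (k + c *: v).
Proof.
move=> t0 df.
have [||c] := @MVT R (fun s => f (k + s *: v))
    (fun s => 'D_v f (k + s *: v)) 0 t t0.
- by move=> x _; exact: is_derive_line.
- apply: derivable_within_continuous => x _.
  by have [] := is_derive_line (df (k + x *: v)).
- rewrite in_itv/= scale0r addr0 subr0 mulrC => ct E.
  by exists c.
Qed.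

Lemma derive_at_max f v k : (forall x, derivable f x v) ->
  (forall x, f x <= f k) -> 'D_v f k = 0.
Proof.
move=> df fmax.
have dl (x : R) : is_derive x 1 (fun s => f (k + s *: v)) ('D_v f (k + x *: v)).
  exact: is_derive_line.
have [] // := @derive1_at_max R (fun s => f (k + s *: v)) (-1) 1 0.
- by rewrite in_itv /= ltrN10 ltr01.
- by move=> t _; rewrite scale0r addr0.
- by move=> _; have [_] := dl 0; rewrite scale0r addr0 => ->.
Qed.

(** Otherwise ['D_v f], which vanishes at the maximum point, would be positive just beyond it, and
    the mean value theorem would push [f] above its maximum. *)
Lemma derive2_at_max f v k : (forall x, derivable f x v) ->
  derivable ('D_v f) k v -> (forall x, f x <= f k) -> 'D_v ('D_v f) k <= 0.
Proof.
move=> df d2f fmax; rewrite leNgt; apply/negP => d2pos.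
have d10 : 'D_v f k = 0 by exact: derive_at_max.
have d2c : (fun h => h^-1 *: (('D_v f \o shift k) (h *: v) - 'D_v f k)) @ 0^'
  --> 'D_v ('D_v f) k by exact: d2f.
have /(_ _) := cvgr_gt _ d2c _ d2pos.
rewrite near_withinE => /nbhs_ballP[e /= e0 He].
have [c /andP[c0 ce]] := @derive_MVT f k v e e0 df.
have := He c; rewrite /ball/= sub0r normrN gtr0_norm// => /(_ ce).
rewrite gt_eqF// d10 subr0 addrC => /(_ isT).
rewrite [_ *: _]/(_ * _) pmulr_rgt0 ?invr_gt0// => dpos E.
have := fmax (k + e *: v); rewrite -subr_le0 E leNgt.
by rewrite mulr_gt0.
Qed.

(** The mean value theorem acts twice: along [u] on the first difference [F] in direction [v], then
    along [v] on ['D_u f]. *)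
Lemma second_increment f u v k s : 0 < s ->
  (forall x, derivable f x u) -> (forall x, derivable ('D_u f) x v) ->
  exists a b, [/\ 0 < a < s, 0 < b < s &
    f (k + s *: u + s *: v) - f (k + s *: u) - (f (k + s *: v) - f k) =
    s * (s * 'D_v ('D_u f) (k + (a *: u + b *: v)))].
Proof.
move=> s0 dfu dfuv.
pose F := fun x => f (x + s *: v) - f x.
have dF x : is_derive x u F ('D_u f (x + s *: v) - 'D_u f x).
  rewrite -derive_translate; apply: is_deriveB; apply: derivableP => //.
  exact: derivable_translate.
have [a as0 Ea] := @derive_MVT F k u s s0 (fun x => @ex_derive _ _ _ _ _ _ _ (dF x)).
have [b bs Eb] := @derive_MVT ('D_u f) (k + a *: u) v s s0 dfuv.
exists a, b; split => //; rewrite addrA -Eb.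
by have [_ <-] := dF (k + a *: u); rewrite -Ea.
Qed.

(** Schwarz's theorem. The double increment over the parallelogram with sides [s *: u] and [s *: v]
    is symmetric in [u] and [v], so the two mixed derivatives share a value, taken at possibly
    different points of it; for small [s] this value is within [e / 2] of both derivatives at
    [k]. *)
Lemma derive_comm f u v k :
  (forall x, derivable f x u) -> (forall x, derivable f x v) ->
  (forall x, derivable ('D_u f) x v) -> (forall x, derivable ('D_v f) x u) ->
  {for k, continuous ('D_v ('D_u f))} -> {for k, continuous ('D_u ('D_v f))} ->
  'D_v ('D_u f) k = 'D_u ('D_v f) k.
Proof.
move=> dfu dfv dfuv dfvu cuv cvu.
apply/eqP; rewrite -subr_eq0 -normr_le0; apply/ler_addgt0Pr => e e0; rewrite add0r.
have tri (p q r : R) : `|p - r| < e / 2 -> `|q - r| < e / 2 -> `|p - q| <= e.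
  move=> pr qr; rewrite (splitr e) (le_trans (ler_distD r p q))// ltW// ltrD//.
  by rewrite distrC.
have e2 : 0 < e / 2 by rewrite divr_gt0.
move/cvgr_dist_lt : cuv => /(_ _ e2)/nbhs_ballP[d1 /= d10 H1].
move/cvgr_dist_lt : cvu => /(_ _ e2)/nbhs_ballP[d2 /= d20 H2].
pose d := Num.min d1 d2.
have d0 : 0 < d by rewrite lt_min d10.
(* The summand 1 keeps [N] positive when [u = v = 0]; with [s = d / N] the parallelogram stays in
   the ball of radius [d]. *)
pose N := `|u| + `|v| + 1.
have N0 : 0 < N by rewrite ltr_wpDl// addr_ge0.
pose s := d / N; have s0 : 0 < s by rewrite divr_gt0.
have near a b : 0 < a < s -> 0 < b < s -> ball k d (k + (a *: u + b *: v)).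
  move=> /andP[a0 as0] /andP[b0 bs].
  rewrite -ball_normE /ball_/= opprD addNKr normrN.
  apply: (le_lt_trans (ler_normD _ _)); rewrite !normrZ !gtr0_norm//.
  apply: (@le_lt_trans _ _ (s * `|u| + s * `|v|)).
    by apply: lerD; rewrite ler_wpM2r// ltW.
  by rewrite -mulrDr /s mulrAC ltr_pdivrMr// ltr_pM2l// ltrDl.
have [a [b [as0 bs Eab]]] := second_increment k s0 dfu dfuv.
have [b' [a' [bs' as' Eba]]] := second_increment k s0 dfv dfvu.
have E : 'D_v ('D_u f) (k + (a *: u + b *: v)) =
         'D_u ('D_v f) (k + (b' *: v + a' *: u)).
  set X := 'D_v _ _ in Eab *; set Y := 'D_u _ _ in Eba *.
  have : s * (s * X) = s * (s * Y).
    apply: (etrans (esym Eab)); apply: etrans Eba.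
    rewrite (addrAC k (s *: v)).
    by move: (f _) (f _) (f _) (f _) => p q r o; ring.
  by move=> /(mulfI (lt0r_neq0 s0)) /(mulfI (lt0r_neq0 s0)).
have h1 : `|'D_v ('D_u f) k - 'D_v ('D_u f) (k + (a *: u + b *: v))| < e / 2.
  by apply: H1; apply: le_ball (near _ _ as0 bs); rewrite ge_min lexx.
have h2 : `|'D_u ('D_v f) k - 'D_v ('D_u f) (k + (a *: u + b *: v))| < e / 2.
  rewrite E (addrC (b' *: v)).
  by apply: H2; apply: le_ball (near _ _ as' bs'); rewrite ge_min lexx orbT.
exact: tri h1 h2.
Qed.

End DirectionalDerivatives.

(** * Harmonic functions on the torus *)

(* MathComp-Analysis has another [periodic], which shadows the one of Defs. *)
Local Notation periodic := Defs.periodic.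

(** * Smooth fields: commuting partial derivatives and the componentwise Hodge Laplacian *)

Section SmoothFields.
Variables (R : realType) (d : nat).
Implicit Types (f g h : 'rV[R]_d -> R) (i j a b : 'I_d).

Lemma smooth_derivable f i k : smooth f -> derivable f k (delta_mx 0 i).
Proof. by move=> /(_ [::])[_]; apply. Qed.

Lemma smooth_continuous f : smooth f -> continuous f.
Proof. by move=> /(_ [::])[]. Qed.

Lemma smooth_partial f i : smooth f -> smooth (partial i f).
Proof. by move=> sf s; have := sf (rcons s i); rewrite /iter_partial foldr_rcons. Qed.

Lemma partial_comm f i j : smooth f ->
  partial i (partial j f) = partial j (partial i f).
Proof.
move=> sf; apply/funext => k; apply: derive_comm.
- by move=> x; apply: smooth_derivable.
- by move=> x; apply: smooth_derivable.
- by move=> x; apply: smooth_derivable; apply: smooth_partial.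
- by move=> x; apply: smooth_derivable; apply: smooth_partial.
- by apply: smooth_continuous; do 2!apply: smooth_partial.
- by apply: smooth_continuous; do 2!apply: smooth_partial.
Qed.

Lemma partialN f i : smooth f -> partial i (- f) = - partial i f.
Proof. by move=> sf; apply/funext => k; apply: deriveN; exact: smooth_derivable. Qed.

Lemma partialD3 f g h i : smooth f -> smooth g -> smooth h ->
  partial i (f + g + h) = partial i f + partial i g + partial i h.
Proof.
move=> sf sg sh; apply/funext => k.
have df := @smooth_derivable _ i k sf; have dg := @smooth_derivable _ i k sg.
rewrite /partial deriveD; [|exact: derivableD|exact: smooth_derivable].
by rewrite deriveD.
Qed.

Lemma partial_sum (F : 'I_d -> 'rV[R]_d -> R) i : (forall a, smooth (F a)) ->
  partial i (\sum_a F a) = \sum_a partial i (F a).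
Proof.
move=> sF; apply/funext => k; rewrite /partial (@derive_sum R _ R^o d F k (delta_mx 0 i)).
  by rewrite fct_sumE.
by move=> a; exact: smooth_derivable.
Qed.

Lemma partialNsum (F : 'I_d -> 'rV[R]_d -> R) i : (forall a, smooth (F a)) ->
  partial i (- \sum_a F a) = - \sum_a partial i (F a).
Proof.
move=> sF; rewrite -partial_sum//; apply/funext => k; apply: deriveN.
by apply: (@derivable_sum R _ R^o) => a; exact: smooth_derivable.
Qed.

(** Flat Weitzenboeck formula: by alternation and commuting partial derivatives, the mixed terms of
    the two compositions are opposite, and only the pure second derivatives survive. *)
Lemma hodge_laplacian2E (w : 'I_d -> 'I_d -> 'rV[R]_d -> R) i j :
  alternating2 w -> (forall a b, smooth (w a b)) ->
  hodge_laplacian2 (@partial R d) w i j =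
  - \sum_a partial a (partial a (w i j)).
Proof.
move=> altw sw.
have sp a b c : smooth (partial a (w b c)) by apply: smooth_partial.
rewrite /hodge_laplacian2 /ext_deriv1 /codiff3 /codiff2 /ext_deriv2.
rewrite !partialNsum//.
have -> : \sum_a partial a (partial a (w i j) + partial i (w j a) + partial j (w a i)) =
  \sum_a partial a (partial a (w i j)) - \sum_a partial i (partial a (w a j))
  + \sum_a partial j (partial a (w a i)).
  rewrite -sumrB -big_split /=; apply: eq_bigr => a _.
  rewrite (partialD3 a (sp _ _ _) (sp _ _ _) (sp _ _ _)).
  rewrite (partial_comm a j (sw a i)); congr (_ + _ + _).
  by rewrite (partial_comm a i (sw j a)) (altw a j) !partialN.
have cancel (M : zmodType) (x y z : M) : - y - - z - (x - y + z) = - x.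
  by rewrite opprK !opprD opprK addrA addrAC addrK addrCA addNr addr0.
exact: cancel.
Qed.

Lemma partial0_const f : smooth f -> (forall i, partial i f = 0) ->
  forall k, f k = f 0.
Proof.
move=> sf pf0 k.
have step i t x : f (x + t *: delta_mx 0 i) = f x.
  (* [derive_MVT] asks for a positive step; a negative one is a positive step read backwards from
     its endpoint. *)
  wlog t0 : t x / 0 < t.
    move=> H; have [t0|t0|->] := ltgtP t 0; [|exact: H|by rewrite scale0r addr0].
    by rewrite -(H (- t)) ?oppr_gt0// -addrA -scalerDl subrr scale0r addr0.
  have [c _ E] := derive_MVT x t0 (fun y => @smooth_derivable f i y sf).
  apply/eqP; rewrite -subr_eq0 E.
  by have := congr1 (@^~ (x + c *: delta_mx 0 i)) (pf0 i);
    rewrite /partial => ->; rewrite mulr0.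
rewrite -(add0r k) (row_sum_delta k).
apply: (big_ind (fun w => forall x, f (x + w) = f x)).
- by move=> x; rewrite addr0.
- by move=> u v Hu Hv x; rewrite addrA Hv Hu.
- by move=> i _ x; rewrite step.
Qed.

(** Supplies what [derive2_at_max] asks of a square along one axis, directly from the product rule;
    [partial2_comb] does the same for the combination in Bernstein's function. *)
Lemma partial2_sqr f i : smooth f ->
  let q := fun x => f x * f x in
  [/\ forall k, derivable q k (delta_mx 0 i),
      forall k, derivable (partial i q) k (delta_mx 0 i) &
      forall k, partial i (partial i q) k =
        2 * (partial i f k ^+ 2 + f k * partial i (partial i f) k)].
Proof.
move=> sf q.
have df k : derivable f k (delta_mx 0 i) by exact: smooth_derivable.
have ddf k : derivable (partial i f) k (delta_mx 0 i).
  by apply: smooth_derivable; exact: smooth_partial.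
pose h := fun x => f x * partial i f x.
have E : partial i q = h + h.
  by apply/funext => x; exact: (deriveM (df x) (df x)).
have dh k : derivable h k (delta_mx 0 i) by exact: (derivableM (df k) (ddf k)).
split=> [k|k|k]; first exact: (derivableM (df k) (df k)).
  by rewrite E; exact: (derivableD (dh k) (dh k)).
rewrite E; apply: (etrans (deriveD (dh k) (dh k))).
have -> : derive h k (delta_mx 0 i) =
    f k * partial i (partial i f) k + partial i f k * partial i f k.
  exact: (deriveM (df k) (ddf k)).
by move: (f k) (partial _ _ _) (partial _ _ _) => x y z; ring.
Qed.

Lemma partial2_comb f g (c : R) i :
  (forall k, derivable f k (delta_mx 0 i)) ->
  (forall k, derivable (partial i f) k (delta_mx 0 i)) ->
  (forall k, derivable g k (delta_mx 0 i)) ->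
  (forall k, derivable (partial i g) k (delta_mx 0 i)) ->
  let q := fun x => f x + c * g x in
  [/\ forall k, derivable q k (delta_mx 0 i),
      forall k, derivable (partial i q) k (delta_mx 0 i) &
      forall k, partial i (partial i q) k =
        partial i (partial i f) k + c * partial i (partial i g) k].
Proof.
move=> df ddf dg ddg q.
have comb (p r : 'rV[R]_d -> R) k : derivable p k (delta_mx 0 i) ->
    derivable r k (delta_mx 0 i) ->
    derivable (fun x => p x + c * r x) k (delta_mx 0 i) /\
    partial i (fun x => p x + c * r x) k = partial i p k + c * partial i r k.
  move=> dp dr.
  have dcr : derivable (fun x => c * r x) k (delta_mx 0 i).
    exact: (derivableM (derivable_cst c k (delta_mx 0 i)) dr).
  split; first exact: (derivableD dp dcr).
  have <- : derive (fun x => c * r x) k (delta_mx 0 i) = c * partial i r k.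
    exact: (deriveMl c dr).
  exact: (deriveD dp dcr).
have E : partial i q = fun x => partial i f x + c * partial i g x.
  by apply/funext => x; have [] := comb _ _ _ (df x) (dg x).
split=> k; first by have [] := comb _ _ _ (df k) (dg k).
  by rewrite E; have [] := comb _ _ _ (ddf k) (ddg k).
by rewrite E; have [] := comb _ _ _ (ddf k) (ddg k).
Qed.

End SmoothFields.

(** * Liouville's theorem on the torus: periodic harmonic functions are constant *)

Section Liouville.
Variables (R : realType) (d : nat) (L : 'M[R]_d).
Hypothesis Lu : L \in unitmx.
Implicit Types (f g h : 'rV[R]_d -> R) (i j a b : 'I_d).

Lemma periodic_partial f i : periodic L f -> periodic L (partial i f).
Proof.
move=> pf k j.
have E : (fun x => f (x + row j L)) = f by apply/funext => x; exact: pf.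
by rewrite /partial -(derive_translate f) E.
Qed.

Lemma periodic_lattice f (z : 'I_d -> int) k : periodic L f ->
  f (k + \sum_i (z i)%:~R *: row i L) = f k.
Proof.
move=> pf; move: k.
apply: (big_ind (fun w => forall x, f (x + w) = f x)).
- by move=> x; rewrite addr0.
- by move=> u v Hu Hv x; rewrite addrA Hv Hu.
move=> i _.
have nat_step n x : f (x + n%:R *: row i L) = f x.
  elim: n x => [|n IH] x; first by rewrite scale0r addr0.
  by rewrite -natr1 scalerDl scale1r addrA pf IH.
case: (z i) => n x; first exact: nat_step.
(* [Negz n] denotes -(n+1), so n+1 forward periods lead back to [x]. *)
by rewrite -(nat_step n.+1) -addrA -scalerDl NegzE mulrNz addNr scale0r addr0.
Qed.

Lemma continuous_sum (T : topologicalType) (X : Type) (r : seq X) (F : X -> T -> R) :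
  (forall x, continuous (F x)) -> continuous (fun t => \sum_(x <- r) F x t).
Proof.
move=> cF; elim: r => [|x r IH].
  have -> : (fun t => \sum_(x <- [::]) F x t) = cst 0.
    by apply/funext => t; rewrite big_nil.
  exact: cst_continuous.
have -> : (fun t => \sum_(y <- x :: r) F y t) =
    (fun t => F x t + \sum_(y <- r) F y t).
  by apply/funext => t; rewrite big_cons.
by move=> t; apply: cvgD; [exact: cF|exact: IH].
Qed.

Lemma continuous_mulmxr : continuous (fun t : 'rV[R]_d => t *m L).
Proof.
have entry (i : 'I_1) j : continuous (fun t : 'rV[R]_d => (t *m L) i j : R).
  have -> : (fun t : 'rV[R]_d => (t *m L) i j : R) =
      (fun t => \sum_a t i a * L a j).
    by apply/funext => t; rewrite mxE.
  apply: continuous_sum => a t.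
  have c : (fun s : 'rV[R]_d => s i a) @ t --> t i a by exact: coord_continuous.
  exact: (cvgM c (cvg_cst (L a j))).
(* A neighbourhood of a row vector contains a finite product of neighbourhoods of its entries, so
   continuity of each entry suffices. *)
move=> t A [P HP PA].
have H : nbhs t [set s | forall (i : 'I_1) j, P i j ((s *m L) i j)].
  apply: (@filter_forall _ 'I_1
    (fun (i : 'I_1) s => forall j, P i j ((s *m L) i j)) (nbhs t)).
  move=> i; apply: (@filter_forall _ 'I_d (fun j s => P i j ((s *m L) i j)) (nbhs t)).
  by move=> j; have := @entry i j t (P i j) (HP i j).
by apply: filterS H => s Hs; apply: PA.
Qed.

(** The maximum over the compact unit cube, pulled back by [L], is global because every point is a
    lattice translate of a point of the unit cell. *)
Lemma periodic_attains_max f : continuous f -> periodic L f ->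
  exists k0, forall k, f k <= f k0.
Proof.
move=> cf pf.
pose C : set 'rV[R]_d := [set v | forall i : 'I_d, `[0%R, 1%R]%classic (v 0 i)].
have cC : compact C 
  by apply: (@rV_compact R d (fun=> `[0%R, 1%R]%classic)) => i; exact: segment_compact.
have C0 : C !=set0 by exists 0 => i /=; rewrite mxE in_itv/= lexx ler01.
have cg : continuous (fun t : 'rV[R]_d => f (t *m L)).
  by move=> t; apply: continuous_comp; [exact: continuous_mulmxr|exact: cf].
have [t0 _ Ht0] := EVT_max_rV C0 cC (continuous_subspaceT cg).
exists (t0 *m L) => k.
(* Coordinates of [k] in the lattice basis; subtracting their floors brings [k] into the cell. *)
pose s := k *m invmx L.
have -> : f k = f ((\row_i (s 0 i - (Num.floor (s 0 i))%:~R)) *m L).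
  rewrite -[in RHS](periodic_lattice (fun i => Num.floor (s 0 i)) _ pf).
  congr f; rewrite mulmx_sum_row -big_split /= -[LHS](mulmxKV Lu) mulmx_sum_row.
  by apply: eq_bigr => i _; rewrite mxE -scalerDl subrK.
apply: Ht0; rewrite inE => i /=; rewrite mxE in_itv/=.
have /andP[] := Num.Theory.floor_itv (s 0 i).
by rewrite intrD => h1 h2; rewrite subr_ge0 h1 lerBlDl ltW.
Qed.

Lemma harmonic_periodic_const f : smooth f -> periodic L f ->
  \sum_a partial a (partial a f) = 0 -> forall k, f k = f 0.
Proof.
move=> sf pf hf; apply: (partial0_const sf) => a; apply/funext => k.
pose u := partial a f.
have su : smooth u by exact: smooth_partial.
have pu : periodic L u by exact: periodic_partial.
(* The Laplacian commutes with [partial a], so [u] is harmonic too. *)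
have hu : \sum_b partial b (partial b u) = 0.
  have -> : \sum_b partial b (partial b u) = partial a (\sum_b partial b (partial b f)).
    rewrite partial_sum; last by move=> b; do 2!apply: smooth_partial.
    apply: eq_bigr => b _; rewrite /u (partial_comm b a sf).
    by rewrite (partial_comm b a (smooth_partial b sf)).
  by rewrite hf; apply/funext => x; exact: derive_cst.
have sumE (g : 'rV[R]_d -> R) x : \sum_b partial b (partial b g) = 0 ->
    \sum_b partial b (partial b g) x = 0.
  by move=> /(congr1 (@^~ x)); rewrite fct_sumE.
pose q (g : 'rV[R]_d -> R) := fun x => g x * g x.
have cq g : continuous g -> continuous (q g).
  by move=> cg x; exact: (cvgM (cg x) (cg x)).
have pq g : periodic L g -> periodic L (q g) by move=> pg x i; rewrite /q pg.
(* [q f m] is the maximum of the square of [f], a bound independent of [c]. *)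
have [m Hm] := periodic_attains_max (cq _ (smooth_continuous sf)) (pq _ pf).
have key c : 0 < c -> u k ^+ 2 <= c * q f m.
  move=> c0.
  pose w x := q u x + c * q f x.
  have cw : continuous w.
    move=> x; have Cu := cq _ (smooth_continuous su) x.
    exact: (cvgD Cu (cvgM (cvg_cst c) (cq _ (smooth_continuous sf) x))).
  have pw : periodic L w by move=> x i; rewrite /w (pq _ pu) (pq _ pf).
  have [x0 Hx0] := periodic_attains_max cw pw.
  have arith (p r x p' r' y : R) :
      2 * (p ^+ 2 + x * r) + c * (2 * (p' ^+ 2 + y * r')) <= 0 ->
      p ^+ 2 + c * p' ^+ 2 + (x * r + c * y * r') <= 0 by move=> H; lra.
  (* Half the second derivative of [w] along axis [b] at its maximum. The terms in the second
     derivatives of [u] and [f] have no sign individually; they cancel only after summation over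
     [b]. *)
  have lap b : (partial b u x0 ^+ 2 + c * partial b f x0 ^+ 2) +
      (u x0 * partial b (partial b u) x0 +
       c * f x0 * partial b (partial b f) x0) <= 0.
    have [du ddu Eu] := partial2_sqr b su.
    have [df ddf Ef] := partial2_sqr b sf.
    have [dw ddw Ew] := partial2_comb c du ddu df ddf.
    have H : partial b (partial b w) x0 <= 0 by exact: derive2_at_max dw (ddw x0) Hx0.
    apply: arith; move: H; rewrite (Ew x0) (Eu x0) (Ef x0); exact.
  have u0 : u x0 = 0.
    have sum_le0 (p r r' : 'I_d -> R) x y : \sum_b r b = 0 -> \sum_b r' b = 0 ->
        (forall b, p b + (x * r b + y * r' b) <= 0) -> \sum_b p b <= 0.
      move=> r0 r'0 H.
      have <- : \sum_b (p b + (x * r b + y * r' b)) = \sum_b p b.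
        by rewrite !big_split/= -!mulr_sumr r0 r'0 !mulr0 !addr0.
      by apply: sumr_le0.
    have S0 := sum_le0 _ _ _ _ _ (sumE u x0 hu) (sumE f x0 hf) lap.
    have : c * u x0 ^+ 2 <= 0.
      (* Since [u] is [partial a f], the term [b = a] of the sum contains [c * u x0 ^+ 2];
         everything else is nonnegative. *)
      apply: le_trans S0; rewrite (bigD1 a)//= -addrA addrCA lerDl.
      apply: addr_ge0; first exact: sqr_ge0.
      apply: sumr_ge0 => b _; apply: addr_ge0; first exact: sqr_ge0.
      by apply: mulr_ge0; [exact: ltW|exact: sqr_ge0].
    by rewrite pmulr_rle0// => u2; apply/eqP; rewrite -sqrf_eq0 eq_le u2 sqr_ge0.
  apply: (@le_trans _ _ (w k)).
    by rewrite /w /q expr2 lerDl mulr_ge0 ?(ltW c0)// -expr2 sqr_ge0.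
  by apply: (le_trans (Hx0 k)); rewrite /w {1}/q u0 mul0r add0r ler_pM2l.
have M0 : 0 <= q f m by rewrite /q -expr2 sqr_ge0.
apply/eqP; rewrite -sqrf_eq0 eq_le sqr_ge0 andbT -/u.
apply/ler_addgt0Pr => e e0; rewrite add0r.
(* [q f m] may vanish, so [c] is taken as [e / (q f m + 1)]. *)
have M1 : 0 < q f m + 1 by rewrite ltr_wpDl.
apply: (le_trans (key (e / (q f m + 1)) _)); first by rewrite divr_gt0.
by rewrite mulrAC ler_pdivrMr// ler_pM2l// lerDl.
Qed.

End Liouville.

(** * Integration over the Brillouin zone *)

Section BrillouinZone.
Variables (R : realType) (d : nat) (L : 'M[R]_d).
Implicit Types (f g : 'rV[R]_d -> R).

Lemma bz_int_cst (c : R) : bz_int L (fun=> c) = `|\det L| * c.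
Proof.
rewrite /bz_int; congr (_ * _).
have -> : ((fun=> c) \o cell_point L) = cst c by [].
rewrite Rintegral_cst// [X in fine X](_ : _ = 1%E) ?mulr1//.
exact: probability_setT.
Qed.

Lemma bz_integrable_cst (c : R) : bz_integrable L (fun=> c).
Proof. exact: finite_measure_integrable_cst. Qed.

Lemma bz_integrableD f g : bz_integrable L f -> bz_integrable L g ->
  bz_integrable L (fun k => f k + g k).
Proof. by move=> fi gi; exact: (integrableD measurableT fi gi). Qed.

Lemma bz_integrableZ (c : R) f : bz_integrable L f -> bz_integrable L (fun k => c * f k).
Proof. by move=> fi; exact: (integrableZl measurableT c fi). Qed.

Lemma bz_intD f g : bz_integrable L f -> bz_integrable L g ->
  bz_int L (fun k => f k + g k) = bz_int L f + bz_int L g.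
Proof. by move=> fi gi; rewrite /bz_int -mulrDr -(RintegralD measurableT fi gi). Qed.

Lemma bz_intZ (c : R) f : bz_integrable L f ->
  bz_int L (fun k => c * f k) = c * bz_int L f.
Proof. by move=> fi; rewrite /bz_int mulrCA -(RintegralZl c measurableT fi). Qed.

(** Both claims go through one induction, as splitting off a term of the integral requires
    integrability of the remaining sum. *)
Lemma bz_int_comb (I : Type) (r : seq I) (c : I -> R) (F : I -> 'rV[R]_d -> R) :
  (forall i, bz_integrable L (F i)) ->
  bz_integrable L (fun k => \sum_(i <- r) c i * F i k) /\
  bz_int L (fun k => \sum_(i <- r) c i * F i k) = \sum_(i <- r) c i * bz_int L (F i).
Proof.
move=> Fi; elim: r => [|i r [IHi IH]].
  have -> : (fun k => \sum_(i <- [::]) c i * F i k) = fun=> 0.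
    by apply/funext => k; rewrite big_nil.
  by rewrite big_nil bz_int_cst mulr0; split=> //; exact: bz_integrable_cst.
have -> : (fun k => \sum_(j <- i :: r) c j * F j k) =
    (fun k => c i * F i k + \sum_(j <- r) c j * F j k).
  by apply/funext => k; rewrite big_cons.
have cFi := bz_integrableZ (c i) (Fi i).
by rewrite big_cons bz_intD// bz_intZ// IH; split=> //; exact: bz_integrableD.
Qed.

Lemma bz_integrable_measurable f : bz_integrable L f -> bz_measurable L f.
Proof. by move=> /measurable_int/measurable_EFinP. Qed.

Lemma bz_integrable_bounded f (M : R) : bz_measurable L f ->
  (forall k, `|f k| <= M) -> bz_integrable L f.
Proof.
move=> mf fM; apply: measurable_bounded_integrable => //.
  by rewrite (le_lt_trans (probability_le1 _ _))// ltry.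
by exists M; split; [exact: num_real|move=> x Mx t _; exact: le_trans (fM _) (ltW Mx)].
Qed.

Lemma bz_integrableM_bounded f h (M : R) : bz_integrable L f -> bz_measurable L h ->
  (forall k, `|h k| <= M) -> bz_integrable L (fun k => f k * h k).
Proof.
move=> fi mh hM; apply: (integrableMl measurableT fi mh).
by exists M; split; [exact: num_real|move=> x Mx t _; exact: le_trans (hM _) (ltW Mx)].
Qed.

Hypothesis Lu : L \in unitmx.

Lemma normr_det_gt0 : 0 < `|\det L|.
Proof. by rewrite normr_gt0 -unitfE -unitmxE. Qed.

(** A nonnegative function with zero integral vanishes almost everywhere. As [f] vanishes nowhere,
    the exceptional null set would be the whole cube, which has mass 1. *)
Lemma bz_int_gt0 f : bz_integrable L f -> (forall k, 0 < f k) -> 0 < bz_int L f.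
Proof.
move=> fi f0; rewrite mulr_gt0// ?normr_det_gt0// lt_neqAle.
rewrite Rintegral_ge0 ?andbT; last by move=> t _; exact: ltW.
apply/eqP => /esym; rewrite /Rintegral => I0.
have mf := bz_integrable_measurable fi.
have : (\int[cube_measure R d]_(x in setT) `|(EFin \o (f \o cell_point L)) x|)%E = 0%E.
  under eq_integral do rewrite /= gtr0_norm//.
  rewrite -[LHS]fineK; last exact: (integrable_fin_num measurableT fi).
  by rewrite I0.
move=> /ae_eq_integral_abs => /(_ measurableT) H.
have /H [N [mN N0 sN]] : measurable_fun setT (EFin \o (f \o cell_point L)).
  exact/measurable_EFinP.
have : (cube_measure R d setT <= cube_measure R d N)%E.
  apply: le_measure; rewrite ?inE//.
  by move=> t _; apply: sN => /= /(_ I) [] E; have := f0 (cell_point L t); rewrite E ltxx.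
by rewrite N0 probability_setT lee_fin ler10.
Qed.

End BrillouinZone.

(** * The harmonic part as the mean of the curvature *)

Section HodgeMean.
Variables (R : realType) (d : nat) (L : 'M[R]_d).
Hypothesis Lu : L \in unitmx.

Lemma partial_cst (i : 'I_d) (c : R) : partial i (cst c : 'rV[R]_d -> R) = cst 0.
Proof. by apply/funext => k; exact: derive_cst. Qed.

Lemma smooth_cst (c : R) : smooth (cst c : 'rV[R]_d -> R).
Proof.
move=> s; have [c' ->] : exists c', iter_partial s (cst c : 'rV[R]_d -> R) = cst c'.
  elim: s => [|i s [c' IH]]; first by exists c.
  by exists 0; rewrite /= IH partial_cst.
by split=> [|i k]; [exact: cst_continuous|exact: derivable_cst].
Qed.

Lemma test_function_cst (c : R) : test_function L (cst c).
Proof. by split; first exact: smooth_cst. Qed.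

(** Linearity with coefficient 1 at the zero function gives T 0 = T 0 + T 0. *)
Lemma distribution0 T : distribution_on_torus L T -> T (cst 0) = 0.
Proof.
move=> [lT _]; have := lT 1 _ _ (test_function_cst 0) (test_function_cst 0).
have -> : (fun k => 1 * cst 0 k + cst 0 k) = cst 0 :> ('rV[R]_d -> R).
  by apply/funext => k /=; rewrite mulr0 addr0.
by rewrite mul1r => /eqP; rewrite -subr_eq0 opprD addrA subrr add0r oppr_eq0 => /eqP.
Qed.

Lemma dist_partial_cst T i (c : R) : distribution_on_torus L T ->
  dist_partial i T (cst c) = 0.
Proof. by move=> dT; rewrite /dist_partial partial_cst distribution0// oppr0. Qed.

Lemma harmonic_form_cst (g : 'I_d -> 'I_d -> 'rV[R]_d -> R) : harmonic_form L g ->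
  forall i j, g i j = fun=> g i j 0.
Proof.
move=> [altg sg hg] i j; apply/funext.
have [sij pij] := sg i j.
apply: (harmonic_periodic_const Lu sij pij).
apply/eqP; rewrite -oppr_eq0 -hodge_laplacian2E ?hg//.
by move=> a b; have [] := sg a b.
Qed.

Lemma hodge_decomposition_mean (Omega g : 'I_d -> 'I_d -> 'rV[R]_d -> R) A B :
  hodge_decomposition L Omega g A B ->
  forall i j, g i j = fun=> bz_mean L (Omega i j).
Proof.
move=> [hg dA [_ dB] dec] i j.
have gE := harmonic_form_cst hg i j.
rewrite gE; apply/funext => _; rewrite /bz_mean.
have := dec i j (cst 1) (test_function_cst 1).
have mul1 f : (fun k => f k * cst 1 k) = f :> ('rV[R]_d -> R).
  by apply/funext => k; rewrite mulr1.
rewrite !mul1 => ->.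
have -> : ext_deriv1 (@dist_partial R d) A i j (cst 1) = 0.
  (* Subtraction of distributions is pointwise, so the first equality holds by conversion. *)
  rewrite /ext_deriv1; apply: (etrans (y := dist_partial i (A j) (cst 1) -
    dist_partial j (A i) (cst 1))) => //.
  by rewrite !dist_partial_cst// subrr.
have -> : codiff3 (@dist_partial R d) B i j (cst 1) = 0.
  have E : codiff3 (@dist_partial R d) B i j (cst 1) =
      - (\sum_a dist_partial a (B a i j)) (cst 1) by [].
  by rewrite E fct_sumE big1 ?oppr0// => a _; rewrite dist_partial_cst.
rewrite !addr0 gE !bz_int_cst mulr1 mulrAC divff ?mul1r//.
by rewrite gt_eqF// normr_det_gt0.
Qed.

End HodgeMean.

(** * Covariance under the thermal probability density *)

Section ThermalCovariance.
Variables (R : realType) (d : nat) (L : 'M[R]_d) (beta mu : R) (eps : 'rV[R]_d -> R).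
Hypothesis (Lu : L \in unitmx) (beps : band_energy L eps).
Implicit Types (X Y : 'rV[R]_d -> R).

Notation weight := (thermal_weight beta mu eps).
Notation density := (thermal_density L beta mu eps).
Notation Z := (partition_Z L beta mu eps).
Notation mean := (thermal_mean L beta mu eps).
Notation cov := (thermal_cov L beta mu eps).
Notation integrable := (thermal_integrable L beta mu eps).

Lemma fermi_gt0 k : 0 < fermi beta mu eps k.
Proof. by rewrite invr_gt0 addr_gt0 ?expR_gt0. Qed.

Lemma fermi_lt1 k : fermi beta mu eps k < 1.
Proof. by rewrite invf_lt1 ?ltrDr ?expR_gt0// addr_gt0 ?expR_gt0. Qed.

Lemma thermal_weight_gt0 k : 0 < weight k.
Proof. by rewrite mulr_gt0 ?fermi_gt0// subr_gt0 fermi_lt1. Qed.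

Lemma thermal_weight_le1 k : weight k <= 1.
Proof.
have f0 := fermi_gt0 k; have f1 := fermi_lt1 k.
by apply: mulr_ile1; rewrite ?subr_ge0 ?gerBl ltW.
Qed.

(** The Fermi function depends continuously on [beta * (eps k - mu)], so it inherits measurability
    from the band energy. *)
Lemma measurable_thermal_weight : bz_measurable L weight.
Proof.
have [_ me] := beps.
have cf : continuous (fun x : R => (expR x + 1)^-1).
  move=> x; apply: cvgV; first by rewrite gt_eqF// addr_gt0 ?expR_gt0.
  by apply: cvgD; [exact: continuous_expR|exact: cvg_cst].
have mf : bz_measurable L (fermi beta mu eps).
  apply: (measurableT_comp (continuous_measurable_fun cf)).
  by apply: measurable_funM => //; exact: measurable_funB.
by apply: measurable_funM => //; exact: measurable_funB.
Qed.

Lemma bz_integrable_thermal_weight : bz_integrable L weight.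
Proof.
apply: (bz_integrable_bounded (M := 1)); first exact: measurable_thermal_weight.
by move=> k; rewrite gtr0_norm ?thermal_weight_gt0// thermal_weight_le1.
Qed.

Lemma partition_Z_gt0 : 0 < Z.
Proof.
apply: bz_int_gt0 => //; first exact: bz_integrable_thermal_weight.
by move=> k; exact: thermal_weight_gt0.
Qed.

(** The weight is at most 1, so the density is bounded by [Z^-1]. *)
Lemma bz_integrable_thermal X : bz_integrable L X -> integrable X.
Proof.
move=> iX; apply: (bz_integrableM_bounded (M := Z^-1)) => //.
  by apply: measurable_funM => //; exact: measurable_thermal_weight.
move=> k; rewrite normrM normfV (gtr0_norm partition_Z_gt0).
rewrite gtr0_norm ?thermal_weight_gt0// ler_piMl ?thermal_weight_le1//.
by rewrite invr_ge0 ltW// partition_Z_gt0.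
Qed.

Lemma thermal_integrable_cst (c : R) : integrable (fun=> c).
Proof. by apply: bz_integrable_thermal; exact: bz_integrable_cst. Qed.

Lemma thermal_integrableD X Y : integrable X -> integrable Y ->
  integrable (fun k => X k + Y k).
Proof.
move=> iX iY; rewrite /thermal_integrable; under eq_fun do rewrite mulrDl.
exact: bz_integrableD.
Qed.

Lemma thermal_integrableZ (c : R) X : integrable X -> integrable (fun k => c * X k).
Proof.
move=> iX; rewrite /thermal_integrable; under eq_fun do rewrite -mulrA.
exact: bz_integrableZ.
Qed.

(** Normalization of the thermal density; dividing by [Z] is legitimate because [Z] is positive. *)
Lemma thermal_mean_cst (c : R) : mean (fun=> c) = c.
Proof.
have E : (fun k => c * density k) = (fun k => (c / Z) * weight k).
  by apply/funext => k; rewrite /thermal_density mulrCA mulrC.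
rewrite /thermal_mean E bz_intZ; last exact: bz_integrable_thermal_weight.
by rewrite -/Z divfK// gt_eqF// partition_Z_gt0.
Qed.

Lemma thermal_meanD X Y : integrable X -> integrable Y ->
  mean (fun k => X k + Y k) = mean X + mean Y.
Proof.
move=> iX iY; rewrite /thermal_mean -bz_intD//; congr bz_int.
by apply/funext => k; rewrite mulrDl.
Qed.

Lemma thermal_meanZ (c : R) X : integrable X ->
  mean (fun k => c * X k) = c * mean X.
Proof.
move=> iX; rewrite /thermal_mean -bz_intZ//; congr bz_int.
by apply/funext => k; rewrite mulrA.
Qed.

Lemma thermal_cov_sym X Y : cov X Y = cov Y X.
Proof.
rewrite /thermal_cov [mean X * _]mulrC; congr (thermal_mean _ _ _ _ _ - _).
by apply/funext => k; rewrite mulrC.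
Qed.

Lemma thermal_cov_cst_l (c : R) X : integrable X -> cov (fun=> c) X = 0.
Proof. by move=> iX; rewrite /thermal_cov thermal_meanZ// thermal_mean_cst subrr. Qed.

Lemma thermal_cov_cst_r (c : R) X : integrable X -> cov X (fun=> c) = 0.
Proof. by move=> iX; rewrite thermal_cov_sym thermal_cov_cst_l. Qed.

(** Expanding the product, the terms in [a] and [b] cancel against those of the product of means.
    Integrability of the product of [X] and [Y] allows the mean of the expansion to be split. *)
Lemma thermal_cov_shift (a b : R) X Y : integrable X -> integrable Y ->
  integrable (fun k => X k * Y k) ->
  cov (fun k => a + X k) (fun k => b + Y k) = cov X Y.
Proof.
move=> iX iY iXY.
have ca := thermal_integrable_cst a; have cb := thermal_integrable_cst b.
have cab := thermal_integrable_cst (a * b).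
have aY := thermal_integrableZ a iY; have bX := thermal_integrableZ b iX.
have E : (fun k => (a + X k) * (b + Y k)) =
    (fun k => (a * b + a * Y k) + (b * X k + X k * Y k)).
  by apply/funext => k; ring.
rewrite /thermal_cov E.
rewrite (thermal_meanD (thermal_integrableD cab aY) (thermal_integrableD bX iXY)).
rewrite (thermal_meanD cab aY) (thermal_meanD bX iXY).
rewrite (thermal_meanD ca iX) (thermal_meanD cb iY) !thermal_meanZ// !thermal_mean_cst.
by ring.
Qed.

Lemma thermal_cov_shiftB (a b : R) X Y : integrable X -> integrable Y ->
  integrable (fun k => X k * Y k) ->
  cov (fun k => X k - a) (fun k => Y k - b) = cov X Y.
Proof.
move=> iX iY iXY; rewrite -(thermal_cov_shift (- a) (- b) iX iY iXY).
by congr thermal_cov; apply/funext => k; rewrite addrC.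
Qed.

End ThermalCovariance.

(** * Noise tensors as functions of component covariances *)

Section Noise.
Variables (R : realType) (d : nat) (L : 'M[R]_d) (beta mu : R) (eps : 'rV[R]_d -> R).

Notation cov := (thermal_cov L beta mu eps).
Notation noise := (current_noise L beta mu eps).

Lemma eq_current_noise (kappa : R) (E : 'I_d -> R) F G F' G' i j :
  (forall a b, cov (F i a) (G j b) = cov (F' i a) (G' j b)) ->
  noise kappa E F G i j = noise kappa E F' G' i j.
Proof.
by move=> H; congr (_ * _); apply: eq_bigr => a _; apply: eq_bigr => b _; rewrite H.
Qed.

Lemma current_noise_eq0 (kappa : R) (E : 'I_d -> R) F G i j :
  (forall a b, cov (F i a) (G j b) = 0) -> noise kappa E F G i j = 0.
Proof.
move=> H; rewrite /current_noise big1 ?mulr0// => a _; rewrite big1// => b _.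
by rewrite H !mulr0.
Qed.

End Noise.

Section Noise3.
Variables (R : realType) (L : 'M[R]_3) (beta mu : R) (eps : 'rV[R]_3 -> R).

Notation cov := (thermal_cov L beta mu eps).
Notation noise := (current_noise3 L beta mu eps).

Lemma eq_current_noise3 (kappa : R) (E : 'I_3 -> R) F G F' G' i j :
  (forall a b, cov (F a) (G b) = cov (F' a) (G' b)) ->
  noise kappa E F G i j = noise kappa E F' G' i j.
Proof.
move=> H; congr (_ * _).
by do 4!apply: eq_bigr => ? _; rewrite H.
Qed.

Lemma current_noise3_eq0 (kappa : R) (E : 'I_3 -> R) F G i j :
  (forall a b, cov (F a) (G b) = 0) -> noise kappa E F G i j = 0.
Proof.
move=> H; rewrite /current_noise3 big1 ?mulr0// => a _.
by do 3!rewrite big1// => ? _; rewrite H !mulr0.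
Qed.

(** A single sum over index pairs is the shape that [bz_int_comb] integrates term by term. *)
Lemma pseudovectorE (F : 'I_3 -> 'I_3 -> 'rV[R]_3 -> R) a :
  pseudovector F a =
  fun k => \sum_p (2^-1 * levi_civita R a p.1 p.2) * F p.1 p.2 k.
Proof.
apply/funext => k; rewrite /pseudovector pair_bigA mulr_sumr.
by apply: eq_bigr => p _; rewrite mulrA.
Qed.

Lemma pseudovector_mean (Omega : 'I_3 -> 'I_3 -> 'rV[R]_3 -> R) a :
  curvature_form L Omega ->
  bz_integrable L (pseudovector Omega a) /\
  forall k, pseudovector (fun i j _ => bz_mean L (Omega i j)) a k =
    bz_mean L (pseudovector Omega a).
Proof.
move=> [_ iO].
have iF p : bz_integrable L (Omega p.1 p.2) by have [] := iO p.1 p.2.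
have [intV intE] := bz_int_comb (index_enum ('I_3 * 'I_3)%type)
  (fun p => 2^-1 * levi_civita R a p.1 p.2) iF.
rewrite !pseudovectorE; split=> // k.
rewrite /bz_mean intE mulr_suml.
by apply: eq_bigr => p _; rewrite mulrA.
Qed.

End Noise3.

Local Close Scope classical_set_scope.

Theorem theorem2 (R : realType) :
  (* any dimension *)
  (forall (d : nat) (L : 'M[R]_d)
     (Omega g : 'I_d -> 'I_d -> 'rV[R]_d -> R)
     (A : 'I_d -> ('rV[R]_d -> R) -> R)
     (B : 'I_d -> 'I_d -> 'I_d -> ('rV[R]_d -> R) -> R),
     L \in unitmx -> curvature_form L Omega -> hodge_decomposition L Omega g A B ->
     (forall (i j : 'I_d) (k : 'rV[R]_d), g i j k = bz_mean L (Omega i j)) /\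
     (forall (beta mu : R) (eps : 'rV[R]_d -> R),
        0 < beta -> band_energy L eps ->
        (forall (i j : 'I_d) (X : 'rV[R]_d -> R), thermal_integrable L beta mu eps X ->
           thermal_cov L beta mu eps (g i j) X = 0 /\
           thermal_cov L beta mu eps X (g i j) = 0) /\
        (forall (kappa : R) (E : 'I_d -> R) (i j : 'I_d),
           current_noise L beta mu eps kappa E g g i j = 0 /\
           (forall X : 'I_d -> 'I_d -> 'rV[R]_d -> R,
              (forall a b, thermal_integrable L beta mu eps (X a b)) ->
              current_noise L beta mu eps kappa E g X i j = 0 /\
              current_noise L beta mu eps kappa E X g i j = 0) /\
           (forall X : 'I_d -> 'I_d -> 'rV[R]_d -> R,
              (forall a b, thermal_integrable L beta mu eps (X a b)) ->
              (forall a b a' b', thermal_integrable L beta mu eps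
                                   (fun k => X a b k * X a' b' k)) ->
              let gX := fun a b k => g a b k + X a b k in
              current_noise L beta mu eps kappa E gX gX i j =
              current_noise L beta mu eps kappa E X X i j) /\
           ((forall a b a' b', thermal_integrable L beta mu eps
                                 (fun k => Omega a b k * Omega a' b' k)) ->
            let rest := fun a b k => Omega a b k - g a b k in
            current_noise L beta mu eps kappa E Omega Omega i j =
            current_noise L beta mu eps kappa E rest rest i j)))) /\
  (* three dimensions: the anomalous-Hall vector h *)
  (forall (L : 'M[R]_3)
     (Omega g : 'I_3 -> 'I_3 -> 'rV[R]_3 -> R)
     (A : 'I_3 -> ('rV[R]_3 -> R) -> R)
     (B : 'I_3 -> 'I_3 -> 'I_3 -> ('rV[R]_3 -> R) -> R),
     L \in unitmx -> curvature_form L Omega -> hodge_decomposition L Omega g A B ->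
     let OmegaV := pseudovector Omega in
     let h := fun (a : 'I_3) (_ : 'rV[R]_3) => bz_mean L (OmegaV a) in
     (forall (a : 'I_3) (k : 'rV[R]_3), pseudovector g a k = h a k) /\
     (forall (beta mu : R) (eps : 'rV[R]_3 -> R) (kappa : R) (E : 'I_3 -> R)
        (i j : 'I_3),
        0 < beta -> band_energy L eps ->
        current_noise3 L beta mu eps kappa E h h i j = 0 /\
        (forall X : 'I_3 -> 'rV[R]_3 -> R,
           (forall a, thermal_integrable L beta mu eps (X a)) ->
           current_noise3 L beta mu eps kappa E h X i j = 0 /\
           current_noise3 L beta mu eps kappa E X h i j = 0) /\
        (forall X : 'I_3 -> 'rV[R]_3 -> R,
           (forall a, thermal_integrable L beta mu eps (X a)) ->
           (forall a b, thermal_integrable L beta mu eps (fun k => X a k * X b k)) ->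
           let hX := fun a k => h a k + X a k in
           current_noise3 L beta mu eps kappa E hX hX i j =
           current_noise3 L beta mu eps kappa E X X i j) /\
        ((forall a b, thermal_integrable L beta mu eps
                        (fun k => OmegaV a k * OmegaV b k)) ->
         let rest := fun a k => OmegaV a k - h a k in
         current_noise3 L beta mu eps kappa E OmegaV OmegaV i j =
         current_noise3 L beta mu eps kappa E rest rest i j))) /\
  (* two dimensions *)
  (forall (L : 'M[R]_2)
     (Omega g : 'I_2 -> 'I_2 -> 'rV[R]_2 -> R)
     (A : 'I_2 -> ('rV[R]_2 -> R) -> R)
     (B : 'I_2 -> 'I_2 -> 'I_2 -> ('rV[R]_2 -> R) -> R),
     L \in unitmx -> curvature_form L Omega -> hodge_decomposition L Omega g A B ->
     let Omega_z := z_component Omega in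
     let h := fun _ : 'rV[R]_2 => bz_mean L Omega_z in
     (forall k : 'rV[R]_2, z_component g k = h k) /\
     (forall (beta mu : R) (eps : 'rV[R]_2 -> R),
        0 < beta -> band_energy L eps ->
        current_noise2 L beta mu eps h h = 0 /\
        (forall X : 'rV[R]_2 -> R, thermal_integrable L beta mu eps X ->
           current_noise2 L beta mu eps h X = 0 /\
           current_noise2 L beta mu eps X h = 0) /\
        (forall X : 'rV[R]_2 -> R, thermal_integrable L beta mu eps X ->
           thermal_integrable L beta mu eps (fun k => X k ^+ 2) ->
           let hX := fun k => h k + X k in
           current_noise2 L beta mu eps hX hX = current_noise2 L beta mu eps X X) /\
        (thermal_integrable L beta mu eps (fun k => Omega_z k ^+ 2) ->
         let rest := fun k => Omega_z k - h k in
         current_noise2 L beta mu eps Omega_z Omega_z =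
         current_noise2 L beta mu eps rest rest))).
Proof.
split; [|split].
- move=> d L Omega g A B Lu [_ iO] dec.
  pose c i j := bz_mean L (Omega i j).
  (* With constants in place of [g], the claims below reduce to covariances with constants or to
     translation invariance of the covariance. *)
  have -> : g = fun i j _ => c i j.
    by apply/funext => i; apply/funext => j; exact: hodge_decomposition_mean dec i j.
  split=> // beta mu eps _ beps.
  have icst i j := thermal_integrable_cst beta mu Lu beps (c i j).
  have iOm i j : thermal_integrable L beta mu eps (Omega i j).
    by apply: bz_integrable_thermal => //; have [] := iO i j.
  split=> [i j X iX|kappa E i j].
    by rewrite thermal_cov_cst_l ?thermal_cov_cst_r.
  split; [|split; [|split]].
  + by apply: current_noise_eq0 => a b; exact: thermal_cov_cst_l.
  + move=> X iX; split; apply: current_noise_eq0 => a b.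
      exact: thermal_cov_cst_l.
    exact: thermal_cov_cst_r.
  + by move=> X iX iXX gX; apply: eq_current_noise => a b; exact: thermal_cov_shift.
  (* [rest] differs from [Omega] by a constant in each component, which leaves every covariance
     unchanged. *)
  + move=> iOO rest; apply: eq_current_noise => a b; apply/esym.
    exact: thermal_cov_shiftB.
- move=> L Omega g A B Lu cO dec OmegaV h.
  have -> : g = fun i j _ => bz_mean L (Omega i j).
    by apply/funext => i; apply/funext => j; exact: hodge_decomposition_mean dec i j.
  split=> [a|beta mu eps kappa E i j _ beps].
    (* The pseudovector is linear in the form, so it commutes with the mean: the constant form of
       means has [h] as its pseudovector. *)
    by have [] := pseudovector_mean a cO.
  have icst a := thermal_integrable_cst beta mu Lu beps (bz_mean L (OmegaV a)).
  have iOm a : thermal_integrable L beta mu eps (OmegaV a).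
    by apply: bz_integrable_thermal => //; have [] := pseudovector_mean a cO.
  split; [|split; [|split]].
  + by apply: current_noise3_eq0 => a b; exact: (thermal_cov_cst_l Lu beps _ (icst b)).
  + move=> X iX; split; apply: current_noise3_eq0 => a b.
      exact: thermal_cov_cst_l.
    exact: thermal_cov_cst_r.
  + by move=> X iX iXX gX; apply: eq_current_noise3 => a b; exact: thermal_cov_shift.
  + move=> iOO rest; apply: eq_current_noise3 => a b; apply/esym.
    exact: thermal_cov_shiftB.
- move=> L Omega g A B Lu [_ iO] dec Omega_z h.
  split=> [k|beta mu eps _ beps].
    by rewrite /z_component (hodge_decomposition_mean Lu dec).
  have icst := thermal_integrable_cst beta mu Lu beps (bz_mean L Omega_z).
  have iOm : thermal_integrable L beta mu eps Omega_z.
    by apply: bz_integrable_thermal => //; have [] := iO ord0 ord_max.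
  rewrite /current_noise2; split; [|split; [|split]].
  + by rewrite (thermal_cov_cst_l Lu beps _ icst) mulr0.
  + by move=> X iX; rewrite thermal_cov_cst_l ?thermal_cov_cst_r ?mulr0.
  + move=> X iX iXX; congr (_ * _); exact: thermal_cov_shift.
  + move=> iOO; congr (_ * _); apply/esym; exact: thermal_cov_shiftB.
Qed.
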